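(* For every nonzero real number $x$, $$\left.\frac{\partial W_{\alpha,\beta}(x)}{\partial\beta}\right|_{\alpha=\beta=1}=-\frac12\ln x\,I_0(2\sqrt x)-K_0(2\sqrt x).$$
   Context: The Wright function is $W_{\alpha,\beta}(x)=\sum_{k=0}^\infty\frac{x^k}{k!\,\Gamma(\alpha k+\beta)}$ (with $1/\Gamma=0$ at the poles of $\Gamma$). $I_\nu$ and $K_\nu$ are the modified Bessel functions of the first and second kind. For $x<0$, $\ln x$ and $\sqrt x$ denote principal branches. *)

(* Defs.v *)
From HB Require Import structures.
From mathcomp Require Import all_boot all_order all_algebra.
From mathcomp Require Import all_classical all_reals all_analysis.
From mathcomp Require Import complex.

Set Implicit Arguments.
Unset Strict Implicit.
Unset Printing Implicit Defensive.

Import Order.TTheory GRing.Theory Num.Theory.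
Import numFieldNormedType.Exports.

Local Open Scope classical_set_scope.
Local Open Scope ring_scope.
Local Open Scope complex_scope.

Section gamma.
Variable R : realType.
Implicit Type x : R.

(* Meaningful for [0 < x] only. *)
Definition euler_gamma x : R :=
  \int[@lebesgue_measure R]_(t in `]0, +oo[) (t `^ (x - 1) * expR (- t)).

(* A number of unit steps that brings [x] into the half-line [0 < x]. *)
Definition gamma_shift x : nat :=
  if 0 < x then 0%N else (Num.truncn (- x)).+1.

(* Continuation of the Euler integral to the nonpositive reals by the
   functional equation [Gamma (x + 1) = x * Gamma x]. At a pole the denominator
   vanishes, hence [gamma x = 0] and [(gamma x)^-1 = 0] because [0^-1 = 0]:
   inverses of [gamma] denote the entire function 1/Gamma at every real. *)
Definition gamma x : R :=
  euler_gamma (x + (gamma_shift x)%:R) /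
  \prod_(0 <= i < gamma_shift x) (x + i%:R).

Definition wright (alpha beta x : R) : R :=
  limn (series (fun k : nat =>
    x ^+ k / (k`!%:R * gamma (alpha * k%:R + beta)))).

End gamma.

(* The topology of the complex plane is carried by [R[i]^o]. *)
Section complex_functions.
Variable R : realType.
Implicit Types (z : R[i]) (nu : R).

Definition cexp z : R[i] :=
  (expR (complex.Re z))%:C * (cos (complex.Im z) +i* sin (complex.Im z)).

(* Principal argument, in ]-pi, pi] for [z != 0]. *)
Definition carg z : R :=
  let t := acos (complex.Re z / Normc.normc z) in
  if 0 <= complex.Im z then t else - t.

Definition clog z : R[i] := ln (Normc.normc z) +i* carg z.

Definition cpowR z nu : R[i] :=
  if z == 0 then (nu == 0)%:R else cexp (nu%:C * clog z).

Definition besselI nu z : R[i] :=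
  cpowR (z / 2) nu *
  limn (series (fun k : nat =>
    (z ^+ 2 / 4) ^+ k / (k`!%:R * gamma (nu + k%:R + 1))%:C : R[i]^o)).

Definition besselK_quotient nu z : R[i] :=
  (pi / 2)%:C * (besselI (- nu) z - besselI nu z) / (sin (nu * pi))%:C.

(* [sin (nu * pi) = 0] exactly when [nu] is an integer. *)
Definition besselK nu z : R[i] :=
  if sin (nu * pi) == 0 then
    lim ((besselK_quotient mu z : R[i]^o) @[mu --> nu^'])
  else besselK_quotient nu z.

End complex_functions.

(* Main.v *)
Require Import Defs.
From HB Require Import structures.
From mathcomp Require Import all_boot all_order all_algebra.
From mathcomp Require Import all_classical all_reals all_analysis.
From mathcomp Require Import measurable_realfun.
From mathcomp Require Import complex ring lra.

Set Implicit Arguments.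
Unset Strict Implicit.
Unset Printing Implicit Defensive.

Import Order.TTheory GRing.Theory Num.Theory.
Import numFieldNormedType.Exports.

Local Open Scope classical_set_scope.
Local Open Scope ring_scope.
Local Open Scope complex_scope.

(** Write W(b) for the Wright function at (1, b), with x fixed.  The functional
    equation of Gamma factors each term of W(1 + m), and for small |m|

      W(1 + m) = 1 / Gamma(1 + m) * sum_k x^k / (k! (1 + m) ... (k + m)),

    so W is differentiable at 1 as soon as Gamma is differentiable at 1 and the
    series on the right is differentiable at m = 0.

    On the Bessel side, put z = 2 sqrt x and L = ln x.  Since z^2 / 4 = x and
    ln (z / 2) = L / 2 for the principal branches ([clog_sqrtc]), the series
    of I_m(z) is that of W(1 + m), and I_m(z) = F(m) := exp (m L / 2) W(1 + m)
    ([besselI_sqrt]).  Hence K_0(z), the limit of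
    (pi / 2) (F(- m) - F(m)) / sin (m pi) at 0, is
    - F'(0) = - W'(1) - (L / 2) W(1) ([besselK0_sqrt]).  As I_0(z) = W(1), the
    combination - (L / 2) I_0(z) - K_0(z) leaves W'(1).

    Three analytic facts carry this.  [gammaE_succ] gives
    Gamma(s + 1) = s Gamma(s) on 0 < s by parts on segments that exhaust the
    half-line.  [derivable_euler_gamma] differentiates under the integral
    for s > 2, where the factor ln t is harmless at 0, and descends to s > 0
    by the functional equation.  [derivable_hyp0F1] differentiates the series
    at 0 from a bound of the second order remainder of its terms, which is
    summable against x^k / k!. *)

(** * The functional equation of the Gamma integral *)

Section gamma_integral.
Variable R : realType.
Implicit Types s t x : R.
Local Notation mu := (@lebesgue_measure R).

Lemma exprn_le_fact_expR n x : 0 <= x -> x ^+ n <= n`!%:R * expR x.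
Proof.
move=> x0; case: n => [|n].
  by rewrite expr0 mul1r -expR0 ler_expR.
have f0 : 0 < n.+1`!%:R :> R by rewrite ltr0n fact_gt0.
rewrite mulrC -ler_pdivrMr//.
by apply: le_trans (expR_ge1Dxn n x0); rewrite lerDr ler01.
Qed.

(** One bound for both ends of the half-line: [1] dominates near [0], and
    [t ^+ n] near infinity. *)
Lemma powR_le1Dexprn n s t : 0 < t -> 0 <= s <= n%:R -> t `^ s <= 1 + t ^+ n.
Proof.
move=> t0 /andP[s0 sn]; have [t1|t1] := leP t 1.
  apply: (@le_trans _ _ 1); last by rewrite lerDl exprn_ge0// ltW.
  have t01 : 0 < t <= 1 by rewrite t0.
  by rewrite -[leRHS](powRr0 t); exact: (ger_powR t01).
rewrite (@le_trans _ _ (t ^+ n))// ?lerDr ?ler01//.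
rewrite -(powR_mulrn _ (ltW t0)); exact: (ler_powR (ltW t1)).
Qed.

(** This form of the bound absorbs the logarithm into a shift of the exponent of
    [t] by one in either direction. *)
Lemma ln_norm_le t : 0 < t -> `|ln t| <= t + t^-1.
Proof.
move=> t0; have tV : 0 < t^-1 by rewrite invr_gt0.
have h1 := ltW (ln_sublinear t0); have h2 := ltW (ln_sublinear tV).
rewrite lnV ?posrE// in h2.
by rewrite ler_norml; apply/andP; split; lra.
Qed.

Definition gamma_integrand s t : R := t `^ (s - 1) * expR (- t).

Lemma gamma_integrand_ge0 s t : 0 <= gamma_integrand s t.
Proof. by rewrite mulr_ge0 ?powR_ge0 ?expR_ge0. Qed.

Lemma measurable_gamma_integrand s : measurable_fun setT (gamma_integrand s).
Proof.
apply: measurable_funM; first exact: measurable_powR.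
by apply: measurableT_comp => //; exact: oppr_measurable.
Qed.

(** The integral is taken in the extended reals, so that the functional equation
    can be proved before its finiteness, which is then deduced from it. *)
Definition gammaE s : \bar R :=
  (\int[mu]_(t in `]0%R, +oo[) (gamma_integrand s t)%:E)%E.

Lemma powR_continuous_gt0 s t : 0 < t -> {for t, continuous (fun u => u `^ s)}.
Proof.
move=> t0; apply: differentiable_continuous; apply/derivable1_diffP.
by apply: derivable_powR; rewrite in_itv/= t0.
Qed.

Lemma powR_expRN_cvgn0 s : 0 < s ->
  (n.+1%:R `^ s * expR (- n.+1%:R) : R) @[n --> \oo] --> 0.
Proof.
move=> s0; pose m := (Num.truncn s).+1.
have sm : 0 <= s <= m%:R by rewrite (ltW s0) ltW// truncnS_gt.
(* One more power than [m] is spent on the decay [n.+1%:R^-1]. *)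
pose C : R := 1 + m.+1`!%:R.
apply: (@squeeze_cvgr _ _ _ _ (cst 0) (fun n => C * n.+1%:R^-1)); last 2 first.
- exact: cvg_cst.
- by rewrite -(mulr0 C); apply: cvgMl_tmp; exact: cvg_harmonic.
apply: nearW => n; rewrite mulr_ge0 ?powR_ge0 ?expR_ge0//=.
have n0 : 0 < n.+1%:R :> R by rewrite ltr0n.
have h := powR_le1Dexprn n0 sm.
have h1 := exprn_le_fact_expR 1 (ltW n0).
have h2 := exprn_le_fact_expR m.+1 (ltW n0).
rewrite expRN ler_pdivlMr// mulrAC ler_pdivrMr ?expR_gt0//.
apply: (@le_trans _ _ ((1 + n.+1%:R ^+ m) * n.+1%:R)).
  by rewrite ler_wpM2r// (ltW n0).
rewrite mulrDl -exprSr /C mulrDl; apply: lerD => //.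
by rewrite !mul1r; rewrite expr1 mul1r in h1.
Qed.

Lemma powR_expRN_cvg0 s : 0 < s ->
  (n.+1%:R^-1 `^ s * expR (- n.+1%:R^-1) : R) @[n --> \oo] --> 0.
Proof.
move=> s0; rewrite -[X in _ --> X](mul0r (expR (- 0))); apply: cvgM.
  have /cvg_at_rightP := powR_cvg0 s0; apply; split; last exact: cvg_harmonic.
  by move=> n; rewrite invr_gt0 ltr0n.
apply: (@cvg_comp _ _ _ _ _ _ (nbhs (- 0 : R))); last exact: continuous_expR.
by apply: cvgN; exact: cvg_harmonic.
Qed.

(** Away from [0] both factors are continuously differentiable, so that the
    classical integration by parts applies even where [t `^ (s - 1)] is
    unbounded near [0]. *)
Lemma gamma_by_parts s a b : 0 < a -> a < b ->
  (\int[mu]_(t in `[a, b]) (gamma_integrand (s + 1) t)%:E =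
   (a `^ s * expR (- a) - b `^ s * expR (- b))%:E +
   s%:E * \int[mu]_(t in `[a, b]) (gamma_integrand s t)%:E)%E.
Proof.
move=> a0 ab.
have pos t : t \in `[a, b] -> 0 < t.
  by rewrite in_itv/= => /andP[at_ _]; exact: lt_le_trans at_.
have posoo t : t \in `]a, b[ -> 0 < t.
  by move=> /subset_itv_oo_cc; exact: pos.
have cN : continuous (fun t : R => expR (- t)).
  by move=> t; apply: continuous_comp; [exact: opp_continuous|exact: continuous_expR].
have dN t : is_derive t 1 (fun t : R => - expR (- t)) (expR (- t)).
  have -> : expR (- t) = - (-1 *: expR (- t)) by rewrite scaleN1r opprK.
  apply: is_deriveN; rewrite /GRing.scale/= mulrC.
  exact: (is_derive1_comp (f := expR) (g := -%R)).
have H := @integration_by_parts R (fun t => t `^ s) (fun t => - expR (- t))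
  (fun t => s * t `^ (s - 1)) (fun t => expR (- t)) a b ab.
rewrite /gamma_integrand addrK H.
- have -> : (b `^ s * - expR (- b) - a `^ s * - expR (- a) =
    a `^ s * expR (- a) - b `^ s * expR (- b)) by ring.
  congr (_ + _)%E.
  rewrite -[RHS]oppeK -mulNe -EFinN -integralZl//=; last first.
    apply: continuous_compact_integrable; first exact: segment_compact.
    apply: continuous_in_subspaceT => t; rewrite inE => /pos t0.
    by apply: cvgM; [exact: powR_continuous_gt0|exact: cN].
  by congr (- _)%E; apply: eq_integral => t _; rewrite -EFinM; congr EFin; ring.
- apply: continuous_in_subspaceT => t; rewrite inE => /pos t0.
  by apply: cvgM; [exact: cvg_cst|exact: powR_continuous_gt0].
- split.
  + move=> t /posoo t0; apply: derivable_powR; by rewrite in_itv/= t0.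
  + by apply: cvg_at_right_filter; exact: powR_continuous_gt0.
  + by apply: cvg_at_left_filter; apply: powR_continuous_gt0; exact: lt_trans ab.
- by move=> t /posoo t0; rewrite powR_derive1// in_itv/= t0.
- exact: continuous_subspaceT.
- split.
  + by move=> t _.
  + by apply: cvg_at_right_filter; apply: cvgN; exact: cN.
  + by apply: cvg_at_left_filter; apply: cvgN; exact: cN.
- by move=> t _; rewrite derive1E derive_val.
Qed.

Definition expanding_segment (n : nat) : set R := `[n.+1%:R^-1, n.+2%:R]%classic.

Lemma bigcup_expanding_segment :
  \bigcup_n expanding_segment n = `]0, +oo[%classic.
Proof.
apply/seteqP; split => [t [n _]|t].
  rewrite /expanding_segment /= !in_itv/= andbT => /andP[+ _].
  by apply: lt_le_trans; rewrite invr_gt0 ltr0n.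
rewrite /= in_itv/= andbT => t0.
pose N := (Num.truncn (t + t^-1)).+1.
have tN : t + t^-1 < N%:R by rewrite truncnS_gt.
have tV : 0 < t^-1 by rewrite invr_gt0.
exists N => //; rewrite /expanding_segment/= in_itv/=; apply/andP; split.
  rewrite -[leRHS]invrK lef_pV2 ?posrE ?ltr0n//.
  rewrite -[N.+1]addn1 natrD; lra.
rewrite -[N.+2]addn2 natrD; lra.
Qed.

Lemma gammaE_cvg s :
  (\int[mu]_(t in expanding_segment n) (gamma_integrand s t)%:E)%E @[n --> \oo]
    --> gammaE s.
Proof.
rewrite /gammaE -bigcup_expanding_segment.
apply: ge0_nondecreasing_set_cvg_integral.
- move=> n m nm; apply/subsetPset => t; rewrite /expanding_segment/= !in_itv/=.
  move=> /andP[h1 h2]; apply/andP; split.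
    by apply: le_trans h1; rewrite lef_pV2 ?posrE ?ltr0n// ler_nat.
  by apply: (le_trans h2); rewrite ler_nat.
- by move=> n; exact: measurable_itv.
- move=> n; apply/measurable_EFinP; apply: measurable_funTS.
  exact: measurable_gamma_integrand.
- by move=> n t _; rewrite lee_fin gamma_integrand_ge0.
Qed.

(** The boundary terms of [gamma_by_parts] vanish in the limit because [0 < s],
    and the integrals converge by monotonicity. *)
Lemma gammaE_succ s : 0 < s -> gammaE (s + 1) = (s%:E * gammaE s)%E.
Proof.
move=> s0.
have lim0 : (n.+1%:R^-1 `^ s * expR (- n.+1%:R^-1) -
    n.+2%:R `^ s * expR (- n.+2%:R) : R)%:E @[n --> \oo] --> 0%:E.
  apply: cvg_EFin; first exact: nearW.
  rewrite -[0 in X in _ --> X](subr0 0); apply: cvgB.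
    exact: powR_expRN_cvg0.
  by have := powR_expRN_cvgn0 s0; rewrite -cvg_shiftS.
have parts n : (\int[mu]_(t in expanding_segment n) (gamma_integrand (s + 1) t)%:E =
   (n.+1%:R^-1 `^ s * expR (- n.+1%:R^-1) - n.+2%:R `^ s * expR (- n.+2%:R))%:E +
   s%:E * \int[mu]_(t in expanding_segment n) (gamma_integrand s t)%:E)%E.
  apply: gamma_by_parts; first by rewrite invr_gt0 ltr0n.
  apply: (@le_lt_trans _ _ 1); last by rewrite ltr1n.
  by rewrite invf_le1 ?ler1n ?ltr0n.
have h : (_ @[_ --> \oo] --> _)%E := @gammaE_cvg (s + 1).
apply/esym; rewrite -[LHS]add0e.
apply: (cvg_unique _ _ h) => //.
rewrite (funext parts).
apply: cvgeD => //.
apply: cvgeZl => //; exact: gammaE_cvg.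
Qed.

End gamma_integral.

(** * Differentiability of the Gamma function *)

Section gamma_derivable.
Variable R : realType.
Implicit Types s t x : R.
Local Notation mu := (@lebesgue_measure R).

(** The dominating function is, up to a factor, the density of the exponential
    distribution of rate [1 / 2]. *)
Lemma integrable_expRN_half c :
  mu.-integrable `]0, +oo[ (fun t => (c * expR (- (t / 2)))%:E).
Proof.
have h0 : 0 < 2^-1 :> R by rewrite invr_gt0.
have h := integrable_exponential_pdf h0.
have h1 : mu.-integrable `]0%R, +oo[ (EFin \o exponential_pdf (2^-1 : R)).
  by apply: integrableS h => //; exact: measurableT.
apply: (@eq_integrable _ _ _ mu _ _
  (fun t => (c * 2)%:E * (exponential_pdf (2^-1 : R) t)%:E)%E).
- exact: measurable_itv.
- move=> t; rewrite inE/= in_itv/= andbT => t0.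
  rewrite exponential_pdfE ?(ltW t0)// -EFinM; congr EFin.
  rewrite -mulrA [2 * _]mulrA divff ?pnatr_eq0// mul1r.
  by congr (_ * expR _); ring.
- by apply: integrableZl => //; exact: measurable_itv.
Qed.

Definition decay_const n : R := 1 + 2 ^+ n * n`!%:R.

Lemma decay_const_ge0 n : 0 <= decay_const n.
Proof. by rewrite addr_ge0// mulr_ge0// exprn_ge0. Qed.

(** Half of the exponential decay pays for all powers up to [n], as
    [(t / 2) ^+ n <= n`! * expR (t / 2)]; this is the origin of [decay_const]. *)
Lemma powR_expRN_le n r t : 0 < t -> 0 <= r <= n%:R ->
  t `^ r * expR (- t) <= decay_const n * expR (- (t / 2)).
Proof.
move=> t0 rn.
have h := powR_le1Dexprn t0 rn.
have t20 : 0 <= t / 2 by rewrite divr_ge0// ltW.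
have h1 := exprn_le_fact_expR n t20.
have h2 := exprn_le_fact_expR 0 t20.
have -> : - t = - (t / 2) - t / 2 by lra.
rewrite expRD mulrA ler_wpM2r ?expR_ge0// expRN ler_pdivrMr ?expR_gt0//.
apply: (le_trans h); rewrite mulrDl; apply: lerD.
  by move: h2; rewrite expr0 fact0 !mul1r.
rewrite -mulrA -[in leLHS](divfK (_ : 2 != 0) t) ?pnatr_eq0// mulrC exprMn.
by rewrite ler_wpM2l// exprn_ge0.
Qed.

Lemma gamma_integrable s : 1 <= s ->
  mu.-integrable `]0, +oo[ (EFin \o gamma_integrand s).
Proof.
move=> s1; pose n := (Num.truncn s).+1.
apply: (le_integrable _ _ _ (integrable_expRN_half (decay_const n))) => //.
  apply/measurable_EFinP; apply: measurable_funTS.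
  exact: measurable_gamma_integrand.
move=> t /=; rewrite in_itv/= andbT => t0.
rewrite lee_fin ger0_norm ?gamma_integrand_ge0//.
rewrite ger0_norm ?mulr_ge0 ?decay_const_ge0 ?expR_ge0//.
apply: powR_expRN_le => //; have := truncnS_gt s; rewrite -/n => sn.
by apply/andP; split; lra.
Qed.

Lemma gamma_integrand_derive s t : 0 < t ->
  is_derive s 1 (@gamma_integrand R ^~ t) (gamma_integrand s t * ln t).
Proof.
move=> t0.
have -> : @gamma_integrand R ^~ t = fun u => expR (- t) * expR (ln t * (u - 1)).
  by apply/funext => u; rewrite /gamma_integrand /powR gt_eqF// mulrC;
    congr (_ * expR _); rewrite mulrC.
have d : is_derive s 1 (fun u => ln t * (u - 1)) (ln t).
  rewrite -[X in is_derive _ _ _ X]mulr1 -[X in _ * X]subr0.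
  by apply: (@is_deriveZ _ _ _ (fun u : R => u - 1)); exact: is_deriveB.
have d2 : is_derive s 1 (fun u => expR (ln t * (u - 1)))
    (expR (ln t * (s - 1)) * ln t).
  exact: (is_derive1_comp (f := expR) (g := fun u => ln t * (u - 1))).
have -> : gamma_integrand s t * ln t =
    expR (- t) *: (expR (ln t * (s - 1)) * ln t).
  rewrite /gamma_integrand /powR gt_eqF// /GRing.scale/= mulrA; congr (_ * _).
  by rewrite mulrC; congr (_ * expR _); rewrite mulrC.
exact: is_deriveZ.
Qed.

(** By [ln_norm_le] the derivative of the integrand is at most
    [(t `^ s + t `^ (s - 2)) * expR (- t)]. Both exponents are positive for
    [2 < s], hence one dominating function serves a neighbourhood of [s0]. *)
Lemma derivable_euler_gamma_gt2 s0 : 2 < s0 -> derivable (@euler_gamma R) s0 1.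
Proof.
move=> s02; pose n := (Num.truncn (s0 + 1)).+1.
have := truncnS_gt (s0 + 1); rewrite -/n => sn.
pose G (t : R) := (decay_const n + decay_const n) * expR (- (t / 2)).
apply: (@derivable_under_integral R _ _ mu (@gamma_integrand R) `]0, +oo[%classic
  _ s0 2 (s0 + 1) _ _ _ G) => //.
- by rewrite /= in_itv/=; apply/andP; split; lra.
- move=> s /=; rewrite in_itv/= => /andP[s2 _]; apply: gamma_integrable; lra.
- move=> s t _; rewrite /= in_itv/= andbT => t0.
  by have [] := gamma_integrand_derive s t0.
- by move=> t; rewrite /G mulr_ge0 ?addr_ge0 ?decay_const_ge0 ?expR_ge0.
- exact: integrable_expRN_half.
- move=> s t /=; rewrite !in_itv/= andbT => /andP[s2 s4] t0.
  rewrite partial1of2E; have [_ ->] := gamma_integrand_derive s t0.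
  rewrite normrM ger0_norm ?gamma_integrand_ge0//.
  apply: (@le_trans _ _ (gamma_integrand s t * (t + t^-1))).
    by rewrite ler_wpM2l ?gamma_integrand_ge0 ?ln_norm_le.
  have tn0 : t != 0 by rewrite gt_eqF.
  have -> : gamma_integrand s t * (t + t^-1) =
      t `^ s * expR (- t) + t `^ (s - 2) * expR (- t).
    rewrite /gamma_integrand mulrAC -mulrDl; congr (_ * _).
    rewrite mulrDr; congr (_ + _).
      by rewrite mulrC mulr_powRB1// ?(ltW t0)//; lra.
    rewrite -[t^-1]powR_inv1 ?(ltW t0)// -powRD ?tn0 ?implybT//.
    by congr (_ `^ _); lra.
  rewrite /G mulrDl.
  by apply: lerD; apply: powR_expRN_le => //; apply/andP; split; lra.
Qed.

(** The dominating function of [gamma_integrable] serves [1 <= s]; finiteness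
    for smaller [s] comes from that at [s + 1] by the functional equation. *)
Lemma gammaE_fin_num s : 0 < s -> gammaE s \is a fin_num.
Proof.
move=> s0.
have : gammaE (s + 1) \is a fin_num.
  have s1 : 1 <= s + 1 by lra.
  have h := gamma_integrable s1.
  exact: integrable_fin_num h.
rewrite gammaE_succ//; move: (gammaE s) => [r| |]//.
  by rewrite mulry gtr0_sg// mul1e.
by rewrite mulrNy gtr0_sg// mul1e.
Qed.

Lemma euler_gamma_succ s : 0 < s -> euler_gamma (s + 1) = s * euler_gamma s.
Proof.
move=> s0; have /fineK h := gammaE_fin_num s0.
by apply: EFin_inj; rewrite EFinM h -gammaE_succ// fineK ?gammaE_fin_num ?addr_gt0.
Qed.

(** Dividing twice by the functional equation moves the point into the range of
    [derivable_euler_gamma_gt2]. *)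
Lemma derivable_euler_gamma s0 : 0 < s0 -> derivable (@euler_gamma R) s0 1.
Proof.
move=> s0_gt0.
pose f s := euler_gamma (s + 2) * (s * (s + 1))^-1.
have fE s : 0 < s -> f s = euler_gamma s.
  move=> s_gt0; rewrite /f (_ : s + 2 = s + 1 + 1); last by lra.
  rewrite !euler_gamma_succ ?addr_gt0//.
  by field; rewrite !gt_eqF// addr_gt0.
have n0 : s0 * (s0 + 1) != 0 by rewrite gt_eqF// mulr_gt0// addr_gt0.
apply: (@near_eq_derivable _ _ _ f) => //.
  by near=> s; apply: fE; near: s; exact: lt_nbhsr.
apply: derivableM.
  apply: diff_derivable; apply: differentiable_comp; first exact: differentiableD.
  by apply/derivable1_diffP; apply: derivable_euler_gamma_gt2; lra.
exact: derivableV.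
Unshelve. all: by end_near. Qed.

Lemma euler_gamma1 : euler_gamma 1 = 1 :> R.
Proof.
rewrite /euler_gamma /Rintegral.
rewrite (_ : (\int[mu]_(t in _) _)%E = 1%E)//.
have := integral_exponential_pdf (@ltr01 R) => <-.
rewrite [RHS](_ : _ = \int[mu]_(t in `[0%R, +oo[) (expR (- t))%:E)%E; last first.
  rewrite [RHS]integral_mkcond; apply: eq_integral => t _.
  rewrite /exponential_pdf !patchE; case: ifP => // _.
  by rewrite mul1r mulN1r.
rewrite -integral_itv_obnd_cbnd; last first.
  apply/measurable_EFinP; apply: measurable_funTS.
  by apply: measurableT_comp => //; exact: oppr_measurable.
apply: eq_integral => t _.
by rewrite subrr powRr0 mul1r.
Qed.

Lemma gamma_pos s : 0 < s -> gamma s = euler_gamma s.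
Proof.
by move=> s0; rewrite /gamma /gamma_shift s0 addr0 big_nil divr1.
Qed.

Lemma gamma_rising (mu : R) k : -1 < mu ->
  gamma (mu + k%:R + 1) = gamma (mu + 1) * \prod_(j < k) (j.+1%:R + mu).
Proof.
move=> m1; elim: k => [|k ih]; first by rewrite big_ord0 mulr1 addr0.
have p : 0 < mu + k%:R + 1.
  have : 0 <= k%:R :> R by [].
  lra.
rewrite big_ord_recr/= mulrA -ih.
have -> : mu + k.+1%:R + 1 = (mu + k%:R + 1) + 1 by rewrite -[k.+1]addn1 natrD; lra.
rewrite (gamma_pos (addr_gt0 p ltr01)) (gamma_pos p) (euler_gamma_succ p) mulrC.
congr (_ * _).
by rewrite -[k.+1]addn1 natrD; lra.
Qed.

End gamma_derivable.

(** * Termwise differentiation of the hypergeometric series *)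

Section series_derivative.
Variable R : realType.
Implicit Types (x h : R) (k : nat).

Lemma limn_series_norm_le (u M : R^nat) :
  (forall k, `|u k| <= M k) -> cvgn (series M) ->
  cvgn (series u) /\ `|limn (series u)| <= limn (series M).
Proof.
move=> uM cM.
have cN : cvgn [normed series u].
  apply: series_le_cvg cM => // k; first exact: normr_ge0.
  exact: le_trans (uM k).
split; first exact: normed_cvg.
apply: (le_trans (lim_series_norm cN)).
by apply: lim_series_le => //; exact: uM.
Qed.

(** A summable bound [M k * h ^+ 2] of the second order remainders bounds the
    remainder of the sum by a multiple of [h ^+ 2], so that only the derivatives
    of the terms at [0] have to be computed. *)
Lemma is_derive_series (u : nat -> R -> R) (v M : R^nat) (d : R) : 0 < d ->
  (forall k h, `|h| < d -> `|u k h - u k 0 - h * v k| <= M k * h ^+ 2) ->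
  cvgn (series (u ^~ 0)) -> cvgn (series v) -> cvgn (series M) ->
  is_derive (0 : R) 1 (fun h => limn (series (u ^~ h))) (limn (series v)).
Proof.
move=> d0 uM cu cv cM.
pose F h := limn (series (u ^~ h)).
have Fle h : `|h| < d ->
    `|F h - F 0 - h * limn (series v)| <= limn (series M) * h ^+ 2.
  move=> hd.
  have cMh : cvgn (series (fun k => h ^+ 2 *: M k)) by exact: is_cvg_seriesZ.
  have uMh k : `|u k h - u k 0 - h * v k| <= h ^+ 2 *: M k.
    by rewrite /GRing.scale/= [h ^+ 2 * _]mulrC; exact: uM.
  have [cr rle] := limn_series_norm_le uMh cMh.
  have chv : cvgn (series (fun k => h *: v k)) by exact: is_cvg_seriesZ.
  rewrite [leRHS]mulrC (_ : h ^+ 2 * _ = limn (series (fun k => h ^+ 2 *: M k))); last first.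
    exact/esym/lim_seriesZ.
  apply: le_trans rle.
  have e2 : limn (series (fun k => u k 0 + h *: v k)) = F 0 + h * limn (series v).
    by rewrite (lim_seriesD cu chv); congr (_ + _); exact: lim_seriesZ.
  have e1 : F h = limn (series (fun k => u k h - u k 0 - h * v k)) +
      limn (series (fun k => u k 0 + h *: v k)).
    rewrite -lim_seriesD//; last exact: (is_cvg_seriesD cu chv).
    by congr (limn (series _)); apply/funext => k; rewrite fctE /GRing.scale/=; ring.
  by rewrite e1 e2 -addrA -opprD addrK.
pose S := limn (series M).
have S1 : 0 < `|S| + 1 by rewrite ltr_wpDl.
have cvgF : h^-1 *: (F (h *: 1 + 0) - F 0) @[h --> 0^'] --> limn (series v).
  apply/cvgrPdist_le => e e0; near=> h.
  have h0 : h != 0 by near: h; exact: nbhs_dnbhs_neq.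
  have hd : `|h| < d by near: h; apply: dnbhs0_lt.
  have he : `|h| * (`|S| + 1) <= e.
    rewrite -ler_pdivlMr//; near: h; apply: dnbhs0_le.
    by rewrite divr_gt0.
  rewrite [_ *: 1]mulr1 addr0 -(ler_pM2l (_ : 0 < `|h|)) ?normr_gt0//.
  rewrite -normrM.
  have -> : h * (limn (series v) - h^-1 *: (F h - F 0)) =
      - (F h - F 0 - h * limn (series v)) by rewrite /GRing.scale/=; field.
  rewrite normrN (le_trans (Fle h hd))// -/S.
  rewrite -(real_normK (num_real h)) expr2 mulrCA.
  rewrite ler_wpM2l// mulrC (le_trans _ he)// ler_wpM2l//.
  by rewrite (le_trans (ler_norm S))// lerDl.
apply: DeriveDef; last exact/cvg_lim.
by apply/cvg_ex; exists (limn (series v)).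
Unshelve. all: by end_near. Qed.

Definition inv_rising k h : R := (\prod_(j < k) (j.+1%:R + h))^-1.

(** The derivative of [inv_rising k] at [0], through the recursion that the
    product rule gives for [inv_risingS]. *)
Fixpoint dinv_rising k : R :=
  if k is k'.+1 then dinv_rising k' / k'.+1%:R - inv_rising k' 0 / k'.+1%:R ^+ 2
  else 0.

Lemma inv_risingS k h : inv_rising k.+1 h = inv_rising k h / (k.+1%:R + h).
Proof. by rewrite /inv_rising big_ord_recr/= invfM. Qed.

Lemma inv_rising0_le1 k : 0 <= inv_rising k 0 <= 1.
Proof.
elim: k => [|k /andP[h0 h1]]; first by rewrite /inv_rising big_ord0 invr1 ler01 lexx.
have k0 : 0 < k.+1%:R :> R by rewrite ltr0n.
rewrite inv_risingS addr0 divr_ge0 ?(ltW k0)//= ler_pdivrMr// mul1r (le_trans h1)//.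
by rewrite ler1n.
Qed.

Lemma dinv_rising_le k : `|dinv_rising k| <= 2 ^+ k.
Proof.
elim: k => [|k ih]; first by rewrite /= normr0.
have k1 : 1 <= k.+1%:R :> R by rewrite ler1n.
have k0 : 0 < k.+1%:R :> R by rewrite ltr0n.
have /andP[p0 p1] := inv_rising0_le1 k.
rewrite exprS mulrC mulr_natr mulr2n /= (le_trans (ler_normB _ _))//; apply: lerD.
  rewrite normrM normfV (ger0_norm (ltW k0)) ler_pdivrMr//.
  by rewrite (le_trans ih)// ler_peMr// exprn_ge0.
rewrite normrM (ger0_norm p0) normfV (ger0_norm (exprn_ge0 2 (ltW k0))).
rewrite ler_pdivrMr ?exprn_gt0// (le_trans p1)//.
by rewrite mulr_ege1// exprn_ege1// ler1n.
Qed.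

(** Induction on [k]: dividing by [k.+1%:R + h] at most doubles the previous
    remainder and adds at most [2 * (1 + 2 ^+ k) * h ^+ 2], from the expansion
    of [(k.+1%:R + h)^-1] and the bounds on [inv_rising k 0] and
    [dinv_rising k]. The rate [8] is generous: against [k`!] any geometric rate
    is summable. *)
Lemma inv_rising_expansion k h : `|h| < 2^-1 ->
  `|inv_rising k h - inv_rising k 0 - h * dinv_rising k| <= 8 ^+ k * h ^+ 2.
Proof.
move=> h2; elim: k => [|k ih].
  by rewrite /inv_rising !big_ord0 /= mulr0 subr0 subrr normr0 mulr_ge0// sqr_ge0.
have k1 : 1 <= k.+1%:R :> R by rewrite ler1n.
have /andP[p0 p1] := inv_rising0_le1 k.
have dk := dinv_rising_le k.
have d8 : 2 ^+ k <= 8 ^+ k :> R by rewrite lerXn2r// ?nnegrE//; lra.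
have e8 : 1 <= 8 ^+ k :> R by rewrite exprn_ege1// ler1n.
rewrite !inv_risingS addr0 [dinv_rising _]/= [8 ^+ _]exprS.
move: ih dk p0 p1; move: (inv_rising k h) (inv_rising k 0) (dinv_rising k) => p q d.
move: (8 ^+ k) (2 ^+ k) d8 e8 => E T TE E1.
move: (k.+1%:R : R) k1 => n n1 ih dT q0 q1.
move: h2; rewrite ltr_norml => /andP[hl hr].
have nh : 2^-1 <= n + h by lra.
have nh0 : n + h != 0 by rewrite gt_eqF//; lra.
have n0 : n != 0 by rewrite gt_eqF//; lra.
have inh : 0 <= (n + h)^-1 <= 2.
  apply/andP; split; first by rewrite invr_ge0; lra.
  by rewrite -[leRHS]invrK lef_pV2 ?posrE ?invr_gt0//; lra.
have in1 : 0 <= n^-1 <= 1.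
  by rewrite invr_ge0 invf_le1//; try lra; apply/andP; split; lra.
(* To first order, [(n + h)^-1] has the remainder
   [h ^+ 2 / (n ^+ 2 * (n + h))]. *)
have -> : p / (n + h) - q / n - h * (d / n - q / n ^+ 2) =
   (p - q - h * d) / (n + h) +
   h ^+ 2 * ((q * n^-1 ^+ 2 - d * n^-1) / (n + h)).
  by field; rewrite n0 nh0.
apply: (le_trans (ler_normD _ _)).
have hh : 0 <= h ^+ 2 by exact: sqr_ge0.
move/andP: inh => [i0 i1]; move/andP: in1 => [j0 j1].
have r1 : `|(p - q - h * d) / (n + h)| <= E * h ^+ 2 * 2.
  by rewrite normrM (ger0_norm i0) ler_pM.
have r2 : `|(q * n^-1 ^+ 2 - d * n^-1) / (n + h)| <= (1 + E) * 2.
  rewrite normrM (ger0_norm i0) ler_pM// (le_trans (ler_normB _ _))//.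
  apply: lerD.
    by rewrite ger0_norm ?mulr_ge0 ?exprn_ge0// mulr_ile1 ?exprn_ge0// exprn_ile1.
  by rewrite normrM (ger0_norm j0) (le_trans _ TE)// (le_trans _ dT)// ler_piMr.
have r3 : `|h ^+ 2 * ((q * n^-1 ^+ 2 - d * n^-1) / (n + h))| <= h ^+ 2 * ((1 + E) * 2).
  by rewrite normrM (ger0_norm hh) ler_wpM2l.
apply: (le_trans (lerD r1 r3)).
have -> : E * h ^+ 2 * 2 + h ^+ 2 * ((1 + E) * 2) = (4 * E + 2) * h ^+ 2 by ring.
by rewrite ler_wpM2r//; lra.
Qed.

Lemma inv_rising_bound k h : `|h| < 2^-1 -> `|inv_rising k h| <= 2 ^+ k.
Proof.
move=> h2; elim: k => [|k ih]; first by rewrite /inv_rising big_ord0 invr1 normr1.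
have k1 : 1 <= k.+1%:R :> R by rewrite ler1n.
move: h2; rewrite ltr_norml => /andP[hl hr].
have kh : 2^-1 <= k.+1%:R + h by lra.
rewrite inv_risingS exprSr normrM ler_pM//.
rewrite ger0_norm ?invr_ge0; last by lra.
by rewrite -[X in _ <= X]invrK lef_pV2 ?posrE ?invr_gt0//; lra.
Qed.

(** The confluent hypergeometric limit function 0F1(; 1 + h; x). *)
Definition hyp0F1 x h : R := limn (series (fun k => x ^+ k / k`!%:R * inv_rising k h)).

Lemma cvgn_exp_scaled x (c : R) :
  cvgn (series (fun k => `|x ^+ k / k`!%:R| * c ^+ k)).
Proof.
rewrite (_ : (fun k => _) = exp_coeff (`|x| * c)); first exact: is_cvg_series_exp_coeff.
apply/funext => k; rewrite /exp_coeff/= normrM normrX normfV (ger0_norm (ler0n _ _)).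
by rewrite exprMn mulrAC.
Qed.

Lemma cvgn_hyp0F1 x h : `|h| < 2^-1 ->
  cvgn (series (fun k => x ^+ k / k`!%:R * inv_rising k h)).
Proof.
move=> h2; apply: (limn_series_norm_le _ (@cvgn_exp_scaled x 2)).1 => k.
by rewrite normrM ler_wpM2l// inv_rising_bound.
Qed.

Lemma derivable_hyp0F1 x : derivable (hyp0F1 x) 0 1.
Proof.
have h0 : 0 < 2^-1 :> R by rewrite invr_gt0.
pose a k := x ^+ k / k`!%:R.
apply: (@ex_derive _ _ _ _ _ _ (limn (series (fun k => a k * dinv_rising k)))).
apply: (@is_derive_series (fun k h => a k * inv_rising k h) _
  (fun k => `|a k| * 8 ^+ k) _ h0).
- move=> k h hd.
  have -> : a k * inv_rising k h - a k * inv_rising k 0 - h * (a k * dinv_rising k) =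
     a k * (inv_rising k h - inv_rising k 0 - h * dinv_rising k) by ring.
  by rewrite normrM -mulrA ler_wpM2l// inv_rising_expansion.
- by apply: cvgn_hyp0F1; rewrite normr0.
- apply: (limn_series_norm_le _ (@cvgn_exp_scaled x 2)).1 => k.
  by rewrite normrM ler_wpM2l// dinv_rising_le.
- exact: cvgn_exp_scaled.
Qed.

End series_derivative.

(** * Limits of complex-valued functions *)

Section complex_tools.
Variable R : realType.

Lemma cvg_complex (T : Type) (F : set_system T) {FF : Filter F}
    (f g : T -> R) (a b : R) :
  f t @[t --> F] --> a -> g t @[t --> F] --> b ->
  (f t +i* g t : R[i]^o) @[t --> F] --> (a +i* b : R[i]^o).
Proof.
move=> fa gb; apply/cvgrPdist_lt => -[e e'].
rewrite ltcE/= => /andP[/eqP-> e0].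
have e20 : 0 < e / 2 by rewrite divr_gt0.
move/cvgrPdist_lt : fa => /(_ _ e20) fa; move/cvgrPdist_lt : gb => /(_ _ e20) gb.
near=> t.
have h1 : `|a - f t| < e / 2 by near: t.
have h2 : `|b - g t| < e / 2 by near: t.
have -> : (a +i* b : R[i]^o) - (f t +i* g t) = (a - f t)%:C + (b - g t)%:C * 'i.
  by apply/eqP; rewrite eq_complex/= !(mul0r, mulr0, mulr1, addr0, add0r, subr0) !eqxx.
apply: (le_lt_trans (ler_normD _ _)).
rewrite normrM.
have -> : `|'i : R[i]| = 1 by rewrite normc_def/= expr0n expr1n add0r sqrtr1.
have nC (r : R) : `|r%:C| = `|r|%:C by rewrite normc_def/= expr0n addr0 sqrtr_sqr.
rewrite mulr1 !nC -rmorphD/= ltcR; lra.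
Unshelve. all: by end_near. Qed.

Lemma complex_hausdorff : hausdorff_space (R[i]^o).
Proof. exact: norm_hausdorff. Qed.

Lemma limn_series_real_complex (u : R^nat) : cvgn (series u) ->
  limn (series (fun k => (u k)%:C : R[i]^o)) = (limn (series u))%:C.
Proof.
move=> cu; apply: cvg_lim; first exact: complex_hausdorff.
have -> : series (fun k => (u k)%:C : R[i]^o) = (fun n => (series u n +i* 0 : R[i]^o)).
  by apply/funext => n; rewrite /series/= -rmorph_sum.
by apply: cvg_complex; [exact: cu|exact: cvg_cst].
Qed.

(** Divide numerator and denominator by [h]: the numerator then tends to
    [- 2 * df], and the sine to [pi]. This is the limit that defines [besselK]
    at an integer order. *)
Lemma cvg_odd_quotient (f : R -> R) (df : R) : is_derive (0 : R) 1 f df ->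
  (pi / 2 * (f (- h) - f h) / sin (h * pi)) @[h --> 0^'] --> - df.
Proof.
move=> [dfx <-].
have df0 : is_derive (0 : R) 1 f ('D_1 f 0) by exact: DeriveDef.
pose G h := f (- h) - f h.
have dG : is_derive (0 : R) 1 G (- 'D_1 f 0 - 'D_1 f 0).
  apply: is_deriveB; rewrite -[- _]mulrN1.
  by apply: (is_derive1_comp (f := f) (g := -%R)); rewrite oppr0.
pose s h : R := sin (h * pi).
have ds : is_derive (0 : R) 1 s pi.
  have d1 : is_derive (0 : R) 1 (fun h => h * pi) pi.
    have -> : (fun h => h * pi) = (fun h => pi *: (h : R))
      by apply/funext => h; rewrite mulrC.
    by rewrite -[X in is_derive _ _ _ X]mulr1; exact: is_deriveZ.
  have -> : pi = cos (0 * pi) * pi :> R by rewrite mul0r cos0 mul1r.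
  exact: (is_derive1_comp (f := sin) (g := fun h => h * pi)).
have quot (g : R -> R) (l : R) : g 0 = 0 -> is_derive (0 : R) 1 g l ->
    h^-1 * g h @[h --> 0^'] --> l.
  move=> g0 [dg <-].
  have -> : (fun h => h^-1 * g h) = (fun h => h^-1 *: (g (h *: 1 + 0) - g 0)).
    by apply/funext => h; rewrite g0 subr0 addr0 [_ *: 1]mulr1.
  exact: dg.
have qG := quot G _ _ dG.
have qs := quot s _ _ ds.
have lim : pi / 2 * (h^-1 * G h) / (h^-1 * s h) @[h --> 0^'] --> - 'D_1 f 0.
  have pi0 : pi != 0 :> R by rewrite gt_eqF// pi_gt0.
  have cancel_p (p d : R) : p != 0 -> - d = p / 2 * (- d - d) / p by move=> p0; field.
  rewrite [X in _ --> X](cancel_p pi)//.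
  apply: cvgM; first by apply: cvgMl_tmp; apply: qG; rewrite /G oppr0 subrr.
  by apply: cvgV => //; apply: qs; rewrite /s mul0r sin0.
apply: cvg_trans lim; apply: near_eq_cvg; near=> h.
have h0 : h != 0 by near: h; exact: nbhs_dnbhs_neq.
rewrite invfM invrK -/(s h) /G mulrA [_ * h]mulrC.
by rewrite mulrCA mulVKf.
Unshelve. all: by end_near. Qed.

End complex_tools.

(** * The Wright and Bessel functions *)

Section bessel.
Variable R : realType.
Implicit Types x mu : R.

(** The bound on [mu] keeps every argument of [gamma] positive, where [gamma] is
    the Euler integral and the rising factorials do not vanish. *)
Lemma wright_near x mu : `|mu| < 2^-1 ->
  wright 1 (1 + mu) x = (gamma (1 + mu))^-1 * hyp0F1 x mu /\
  cvgn (series (fun k => x ^+ k / (k`!%:R * gamma (mu + k%:R + 1)))).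
Proof.
move=> m2.
have m1 : -1 < mu by move: m2; rewrite ltr_norml => /andP[? _]; lra.
have E : (fun k => x ^+ k / (k`!%:R * gamma (mu + k%:R + 1))) =
   (fun k => (gamma (1 + mu))^-1 *: (x ^+ k / k`!%:R * inv_rising k mu)).
  apply/funext => k; rewrite gamma_rising// [mu + 1]addrC /inv_rising /GRing.scale/=.
  by rewrite !invfM; ring.
have cp := @cvgn_hyp0F1 R x mu m2.
split; last by rewrite E; exact: is_cvg_seriesZ.
rewrite /wright.
have -> : (fun k => x ^+ k / (k`!%:R * gamma (1 * k%:R + (1 + mu)))) =
   (fun k => x ^+ k / (k`!%:R * gamma (mu + k%:R + 1))).
  by apply/funext => k; rewrite mul1r (_ : k%:R + (1 + mu) = mu + k%:R + 1)//; ring.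
by rewrite E; exact: lim_seriesZ.
Qed.

Lemma derivable_wright x : derivable (fun beta : R => wright 1 beta x) 1 1.
Proof.
pose f beta := (euler_gamma beta)^-1 * hyp0F1 x (beta - 1).
have h0 : 0 < 2^-1 :> R by rewrite invr_gt0.
have fE beta : `|beta - 1| < 2^-1 -> f beta = wright 1 beta x.
  move=> hb; have [+ _] := wright_near x hb.
  rewrite addrCA subrr addr0 => ->; rewrite gamma_pos//.
  by move: hb; rewrite ltr_norml => /andP[? _]; lra.
apply: (@near_eq_derivable _ _ _ f) => //.
  near=> beta; apply: fE; rewrite distrC; near: beta.
  by apply: cvgr_dist_lt => //; exact: cvg_id.
apply: derivableM.
  apply: derivableV; first by rewrite euler_gamma1 oner_neq0.
  exact: derivable_euler_gamma.
apply: diff_derivable; apply: differentiable_comp; first exact: differentiableB.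
by apply/derivable1_diffP; rewrite subrr; exact: derivable_hyp0F1.
Unshelve. all: by end_near. Qed.

Lemma ln_sqrt x : 0 < x -> ln (Num.sqrt x) = ln x / 2.
Proof. by move=> x0; rewrite -powR12_sqrt ?(ltW x0)// ln_powR mulrC. Qed.

Lemma clog_real x : clog x%:C = ln `|x| +i* acos (x / `|x|).
Proof.
have nx : Normc.normc x%:C = `|x| by rewrite /Normc.normc/= expr0n addr0 sqrtr_sqr.
by rewrite /clog /carg nx /= lexx.
Qed.

Lemma clog_imaginary x : 0 < x -> clog (0 +i* x) = ln x +i* (pi / 2).
Proof.
move=> x0.
have nx : Normc.normc (0 +i* x) = x.
  by rewrite /Normc.normc/= expr0n add0r sqrtr_sqr gtr0_norm.
by rewrite /clog /carg nx /= (ltW x0) mul0r acos0.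
Qed.

(** On the negative axis [sqrtc] takes the root on the positive imaginary axis,
    whose argument [pi / 2] is half of the principal argument [pi]. *)
Lemma clog_sqrtc x : x != 0 -> clog (sqrtc x%:C) = 1 / 2 * clog x%:C.
Proof.
have mulE (a b : R) : 1 / 2 * (a +i* b) = (a / 2) +i* (b / 2) :> R[i].
  have -> : 1 / 2 = (2^-1)%:C :> R[i] by rewrite div1r fmorphV/= rmorph_nat.
  by apply/eqP; rewrite eq_complex/= !mul0r subr0 addr0 ![2^-1 * _]mulrC !eqxx.
rewrite clog_real mulE neq_lt => /orP[x0|x0].
- have xN : 0 < - x by rewrite oppr_gt0.
  have -> : sqrtc x%:C = 0 +i* Num.sqrt (- x).
    rewrite /sqrtc/= eqxx mul1r expr0n addr0 sqrtr_sqr ltr0_norm//.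
    rewrite addNr mul0r sqrtr0 (_ : - x - x = - x * 2); last by ring.
    by rewrite mulfK.
  rewrite clog_imaginary ?sqrtr_gt0// ltr0_norm// ln_sqrt//.
  by rewrite invrN mulrN divff ?lt_eqF// acosN1.
- rewrite sqrtc_sqrtr ?lecR ?(ltW x0)//= clog_real !ger0_norm ?sqrtr_ge0 ?(ltW x0)//.
  by rewrite !divff ?gt_eqF ?sqrtr_gt0// acos1 mul0r ln_sqrt.
Qed.

(** For [z = 2 * sqrtc x%:C] the series of [besselI] has the real terms of
    [wright], as [z ^+ 2 / 4 = x]; the branch of the logarithm enters only
    through the power [z / 2] to the [mu]. *)
Lemma besselI_sqrt x mu : x != 0 -> `|mu| < 2^-1 ->
  besselI mu (2 * sqrtc x%:C) =
  cexp (mu%:C * (1 / 2 * clog x%:C)) * (wright 1 (1 + mu) x)%:C.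
Proof.
move=> x0 m2.
have n2 : 2 != 0 :> R[i] by rewrite pnatr_eq0.
have [_ cu] := wright_near x m2.
rewrite /besselI [2 * _]mulrC mulfK// /cpowR sqrtc_eq0 fmorph_eq0 (negbTE x0).
rewrite clog_sqrtc//; congr (_ * _).
have -> : (fun k : nat => ((sqrtc x%:C * 2) ^+ 2 / 4) ^+ k /
    (k`!%:R * gamma (mu + k%:R + 1))%:C : R[i]^o) =
   (fun k => (x ^+ k / (k`!%:R * gamma (mu + k%:R + 1)))%:C : R[i]^o).
  apply/funext => k; rewrite [(_ * 2) ^+ 2]exprMn sqr_sqrtc.
  rewrite -[2 ^+ 2]natrX mulfK ?pnatr_eq0//.
  by rewrite fmorph_div rmorphXn.
rewrite limn_series_real_complex//; congr (_%:C); rewrite /wright.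
congr (limn (series _)); apply/funext => k.
by rewrite mul1r (_ : k%:R + (1 + mu) = mu + k%:R + 1)//; ring.
Qed.

(** With [besselI mu z = U mu +i* V mu], the limit defining [besselK 0 z] is
    [- (U' 0 +i* V' 0)], which [cvg_odd_quotient] gives on each component. *)
Lemma besselK0_sqrt x : x != 0 ->
  besselK 0 (2 * sqrtc x%:C) =
  - (derive1 (fun beta : R => wright 1 beta x) 1)%:C -
  1 / 2 * clog x%:C * (wright 1 1 x)%:C.
Proof.
move=> x0; set dW := derive1 _ 1.
pose S mu := wright 1 (1 + mu) x.
have dS : is_derive (0 : R) 1 S dW.
  have dW1 : is_derive (1 + 0 : R) 1 (fun beta : R => wright 1 beta x) dW.
    by rewrite addr0; apply: DeriveDef; [exact: derivable_wright|rewrite -derive1E].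
  rewrite -[dW]mulr1.
  apply: (is_derive1_comp (f := fun beta => wright 1 beta x) (g := fun mu => 1 + mu)).
  by rewrite -[X in is_derive _ _ _ X]add0r; exact: is_deriveD.
set L := 1 / 2 * clog x%:C.
pose A := complex.Re L; pose B := complex.Im L.
have LE : L = A +i* B by rewrite /A /B; case: (L).
have dlin (c : R) : is_derive (0 : R) 1 (fun mu => mu * c) c.
  have -> : (fun mu => mu * c) = (fun mu => c *: (mu : R))
    by apply/funext => h; rewrite mulrC.
  by rewrite -[X in is_derive _ _ _ X]mulr1; exact: is_deriveZ.
have dexp : is_derive (0 : R) 1 (fun mu => expR (mu * A)) A.
  have d : is_derive (0 : R) 1 (fun mu => expR (mu * A)) (expR (0 * A) * A).
    exact: (is_derive1_comp (f := expR) (g := fun mu => mu * A)).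
  apply: (is_derive_eq d).
  by rewrite mul0r expR0 mul1r.
have dcos : is_derive (0 : R) 1 (fun mu => cos (mu * B)) 0.
  have d : is_derive (0 : R) 1 (fun mu => cos (mu * B)) (- sin (0 * B) * B).
    exact: (is_derive1_comp (f := cos) (g := fun mu => mu * B)).
  apply: (is_derive_eq d).
  by rewrite mul0r sin0 oppr0 mul0r.
have dsin : is_derive (0 : R) 1 (fun mu => sin (mu * B)) B.
  have d : is_derive (0 : R) 1 (fun mu => sin (mu * B)) (cos (0 * B) * B).
    exact: (is_derive1_comp (f := sin) (g := fun mu => mu * B)).
  apply: (is_derive_eq d).
  by rewrite mul0r cos0 mul1r.
pose U mu := expR (mu * A) * cos (mu * B) * S mu.
pose V mu := expR (mu * A) * sin (mu * B) * S mu.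
have W0 : S 0 = wright 1 1 x by rewrite /S addr0.
have dU : is_derive (0 : R) 1 U (A * wright 1 1 x + dW).
  have d := is_deriveM (is_deriveM dexp dcos) dS.
  apply: (is_derive_eq d).
  by rewrite fctE /GRing.scale/= !mul0r expR0 cos0 W0; ring.
have dV : is_derive (0 : R) 1 V (B * wright 1 1 x).
  have d := is_deriveM (is_deriveM dexp dsin) dS.
  apply: (is_derive_eq d).
  by rewrite fctE /GRing.scale/= !mul0r expR0 sin0 W0; ring.
have IE mu : `|mu| < 2^-1 -> besselI mu (2 * sqrtc x%:C) = U mu +i* V mu.
  move=> m2; rewrite besselI_sqrt// -/L LE /cexp /U /V -/(S mu).
  by apply/eqP; rewrite eq_complex/= !(mul0r, mulr0, subr0, addr0, add0r) !eqxx.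
rewrite /besselK mul0r sin0 eqxx.
have -> : - dW%:C - L * (wright 1 1 x)%:C =
    - (A * wright 1 1 x + dW) +i* - (B * wright 1 1 x).
  by rewrite LE; apply/eqP; rewrite eq_complex/=; apply/andP; split; apply/eqP; ring.
apply: (@cvg_lim R[i]^o); first exact: complex_hausdorff.
apply: cvg_trans (cvg_complex (cvg_odd_quotient dU) (cvg_odd_quotient dV)).
apply: near_eq_cvg; near=> mu.
have m2 : `|mu| < 2^-1 by near: mu; apply: dnbhs0_lt; rewrite invr_gt0.
rewrite /besselK_quotient !IE ?normrN//.
have -> : ((sin (mu * pi))%:C)^-1 = ((sin (mu * pi))^-1)%:C by rewrite fmorphV.
by apply/eqP; rewrite eq_complex/=; apply/andP; split; apply/eqP; ring.
Unshelve. all: by end_near. Qed.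

End bessel.

Theorem theorem6p2 (R : realType) (x : R) (hx : x != 0) :
  derivable (fun beta : R => wright 1 beta x) 1 1 /\
  (derive1 (fun beta : R => wright 1 beta x) 1)%:C =
    - (1 / 2) * clog x%:C * besselI 0 (2 * sqrtc x%:C)
    - besselK 0 (2 * sqrtc x%:C).
Proof.
split; first exact: derivable_wright.
rewrite besselK0_sqrt// besselI_sqrt ?normr0 ?invr_gt0// addr0.
have -> : cexp (0%:C * (1 / 2 * clog x%:C)) = 1.
  by rewrite mul0r /cexp/= expR0 cos0 sin0 mul1r.
by rewrite [1 * _%:C]mul1r opprB opprK !mulNr addrA addNr add0r.
Qed.
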